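(* Let $\mathcal{C}_2=\langle u^2(x+1)^\ell\rangle\subseteq\mathcal{S}$, where $0\le \ell\le 2^\varsigma-1$. Then, for every trace orthogonal basis $\mathcal{B}$ of $\mathbb{F}_{2^m}$ over $\mathbb{F}_2$, $$d_L^{\mathcal{B}}(\mathcal{C}_2)=\begin{cases}2 & \text{if } \ell=0,\\ 4 & \text{if } 1\le \ell\le 2^{\varsigma-1},\\ 2^{\gamma+2} & \text{if } 2^\varsigma-2^{\varsigma-\gamma}+1\le \ell\le 2^\varsigma-2^{\varsigma-\gamma}+2^{\varsigma-\gamma-1},\ \text{where } 1\le\gamma\le\varsigma-1.\end{cases}$$
   Context: Let $m,\varsigma$ be positive integers, $\mathcal{R}=\mathbb{F}_{2^m}+u\mathbb{F}_{2^m}+u^2\mathbb{F}_{2^m}$ with $u^3=0$ (i.e. $\mathbb{F}_{2^m}[u]/\langle u^3\rangle$), and $\mathcal{S}=\mathcal{R}[x]/\langle x^{2^\varsigma}-1\rangle$. Cyclic codes of length $2^\varsigma$ over $\mathcal{R}$ are the ideals of $\mathcal{S}$; the class of $c_0+c_1x+\cdots+c_{2^\varsigma-1}x^{2^\varsigma-1}$ is identified with $(c_0,\dots,c_{2^\varsigma-1})\in\mathcal{R}^{2^\varsigma}$. $\langle\cdot\rangle$ denotes the ideal of $\mathcal{S}$ generated. A trace orthogonal basis (TOB) of $\mathbb{F}_{2^m}$ over $\mathbb{F}_2$ is a basis $\mathcal{B}=\{\zeta_1,\dots,\zeta_m\}$ with $Tr(\zeta_i\zeta_j)=1$ if $i=j$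 and $0$ if $i\ne j$, where $Tr(y)=y+y^2+y^{2^2}+\cdots+y^{2^{m-1}}$ (such bases exist). For $y=\sum_i y_i\zeta_i\in\mathbb{F}_{2^m}$ with $y_i\in\mathbb{F}_2$, $wt_L^{\mathcal{B}}(y)$ is the number of $i$ with $y_i=1$. For $a+ub+u^2c\in\mathcal{R}$ ($a,b,c\in\mathbb{F}_{2^m}$), $wt_L^{\mathcal{B}}(a+ub+u^2c)=wt_L^{\mathcal{B}}(a+b+c)+wt_L^{\mathcal{B}}(b+c)+wt_L^{\mathcal{B}}(b)$. The Lee weight of a vector (or polynomial of degree less than $2^\varsigma$) is the sum of the Lee weights of its entries (coefficients). The Lee distance $d_L^{\mathcal{B}}(\mathcal{C})$ of a nonzero code $\mathcal{C}$ is the minimum Lee weight of its nonzero elements. *)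

(* Defs.v *)
From HB Require Import structures.
From mathcomp Require Import all_boot all_order all_algebra all_field.

Set Implicit Arguments.
Unset Strict Implicit.
Unset Printing Implicit Defensive.

Import GRing.Theory.
Local Open Scope ring_scope.

(* The field with 2^m elements is modelled as a field extension F of 'F_2 of
   dimension m. *)

(* Since 'X^3 is monic of size 4, this is F[u]/<u^3>, and the coefficients of
   r : chain_ring F are the a, b, c of r = a + u b + u^2 c. *)
Definition chain_ring (F : fieldExtType 'F_2) : comNzRingType :=
  {poly %/ ('X^3 : {poly F})}.

Definition u (F : fieldExtType 'F_2) : chain_ring F := 'qX.

(* {poly %/ h} is the quotient by h only if h is monic of size > 1 (otherwise
   it silently becomes the quotient by 'X); see mk_monic_cyclic. *)
Definition cyclic_ring (F : fieldExtType 'F_2) (s : nat) : comNzRingType :=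
  {poly %/ ('X^(2 ^ s)%N - 1 : {poly chain_ring F})}.

Lemma mk_monic_cyclic (F : fieldExtType 'F_2) (s : nat) :
  mk_monic ('X^(2 ^ s)%N - 1 : {poly chain_ring F}) = 'X^(2 ^ s)%N - 1.
Proof.
have s_gt0 : (0 < 2 ^ s)%N by rewrite expn_gt0.
by rewrite /mk_monic -polyC1 size_XnsubC // ltnS s_gt0 monicXnsubC.
Qed.

Definition ideal_gen (A : comNzRingType) (g : A) : A -> Prop :=
  fun z => exists f : A, z = f * g.

Definition code2 (F : fieldExtType 'F_2) (s l : nat) : cyclic_ring F s -> Prop :=
  ideal_gen (qpolyC _ (u F ^+ 2) * ('qX + 1) ^+ l).

Definition Tr (F : fieldExtType 'F_2) (m : nat) (y : F) : F :=
  \sum_(i < m) y ^+ (2 ^ i)%N.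

Definition trace_orthogonal_basis (F : fieldExtType 'F_2) (m : nat)
    (B : m.-tuple F) : Prop :=
  basis_of {:F} B /\
  forall i j : 'I_m, Tr m (tnth B i * tnth B j) = (i == j)%:R.

Section LeeWeight.
Variables (F : fieldExtType 'F_2) (m : nat) (B : m.-tuple F).

Definition lee_weight_field (y : F) : nat :=
  #|[set i : 'I_m | coord B i y == 1]|.

Definition lee_weight_ring (r : chain_ring F) : nat :=
  let p : {poly F} := polyn r in
  let a := p`_0 in let b := p`_1 in let c := p`_2 in
  (lee_weight_field (a + b + c) + lee_weight_field (b + c)
   + lee_weight_field b)%N.

(* The coefficients of (the reduced representative of) c are the entries of
   the corresponding vector of length 2^s. *)
Definition lee_weight (s : nat) (c : cyclic_ring F s) : nat :=
  (\sum_(i < 2 ^ s) lee_weight_ring (polyn c)`_i)%N.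

Definition lee_distance_is (s : nat) (C : cyclic_ring F s -> Prop)
    (d : nat) : Prop :=
  (exists c, [/\ C c, c != 0 & lee_weight c = d]) /\
  (forall c, C c -> c != 0 -> (d <= lee_weight c)%N).

End LeeWeight.

(* Main.v *)
(** Since u^3 = 0, the product u^2 r only depends on r mod u, and u^2 a has Lee
    weight 2 wt(a); so up to this factor 2 the code is the ideal of multiples of
    (x+1)^l in F[x]/(x^n + 1), n = 2^s.  As (x+1)^(2^j) = x^(2^j) + 1 in
    characteristic 2, a polynomial of size at most 2N divisible by (x+1)^N, with
    N = 2^j, has the form q (x^N + 1) with q of size at most N, and weighs twice
    as much as q.  Iterating this gives both the lower bound and the weight of
    the codeword b (x+1)^(2^s - 2^k), b a basis vector. *)

From HB Require Import structures.
Require Import Defs.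
From mathcomp Require Import all_boot all_order all_algebra all_field.
From mathcomp Require Import zify.

Set Implicit Arguments.
Unset Strict Implicit.
Unset Printing Implicit Defensive.

Import GRing.Theory.
Import Pdiv.CommonRing Pdiv.RingMonic.
Local Open Scope ring_scope.

(** * Weights of multiples of powers of X + 1 in characteristic 2 *)

Section CoefWeight.
Variables (R : idomainType) (w : R -> nat).
Hypothesis charR2 : 2%N \in [pchar R].

Definition coef_weight (n : nat) (p : {poly R}) : nat :=
  (\sum_(i < n) w p`_i)%N.

Lemma exprX1_pow2 n : ('X + 1) ^+ (2 ^ n) = 'X^(2 ^ n) + 1 :> {poly R}.
Proof.
have char2 : 2%N \in [pchar {poly R}] by rewrite pchar_poly.
by rewrite exprDn_pchar ?expr1n // pnatX pnatE // char2.
Qed.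

Lemma size_exprX1 n : size (('X + 1 : {poly R}) ^+ n) = n.+1.
Proof. by rewrite -[1]opprK -polyC1 -polyCN size_exp_XsubC. Qed.

Lemma exprX1_neq0 n : ('X + 1 : {poly R}) ^+ n != 0.
Proof. by rewrite -size_poly_gt0 size_exprX1. Qed.

(** The coefficients of [q] and of q X^n occupy disjoint ranges of positions, so each is counted
    exactly twice. *)
Lemma coef_weight_double n (q : {poly R}) : (size q <= n)%N ->
  coef_weight (n + n) (q * ('X^n + 1)) = (2 * coef_weight n q)%N.
Proof.
move=> sq; rewrite /coef_weight big_split_ord /= mul2n -addnn.
congr (_ + _)%N; apply: eq_bigr => i _; rewrite mulrDr mulr1 coefD coefMXn /=.
  by rewrite ltn_ord add0r.
rewrite ltnNge leq_addr /= addKn [q`_(n + i)]nth_default ?addr0 //.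
exact: leq_trans sq (leq_addr _ _).
Qed.

Lemma coef_weight_gt0 n (p : {poly R}) : (forall a, a != 0 -> (0 < w a)%N) ->
  p != 0 -> (size p <= n)%N -> (0 < coef_weight n p)%N.
Proof.
move=> w_gt0 p0 sp; have lt_n : ((size p).-1 < n)%N.
  by rewrite prednK ?size_poly_gt0.
rewrite /coef_weight (bigD1 (Ordinal lt_n)) //= ltn_addr // w_gt0 //.
by rewrite -lead_coefE lead_coef_eq0.
Qed.

(* Writing 2^(g+k) - 2^k as the sum of the 2^j with k <= j < g + k, the power of
   X + 1 is the product of the binomials X^(2^j) + 1. *)
Lemma coef_weight_exprX1 (a : R) g k : w 0 = 0%N ->
  coef_weight (2 ^ (g + k)) (a *: ('X + 1) ^+ (2 ^ (g + k) - 2 ^ k)) =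
  (2 ^ g * w a)%N.
Proof.
move=> w0; elim: g => [|g IHg].
  rewrite add0n subnn expr0 mul1n /coef_weight.
  have k0 : (0 < 2 ^ k)%N by rewrite expn_gt0.
  rewrite (bigD1 (Ordinal k0)) //= big1 ?addn0 ?coefZ ?coef1 ?mulr1 // => i.
  by rewrite -val_eqE /= => /negPf i0; rewrite coefZ coef1 i0 mulr0.
have le_k : (2 ^ k <= 2 ^ (g + k))%N by rewrite leq_exp2l // leq_addl.
rewrite addSn expnS mul2n -addnn -addnBAC // exprD exprX1_pow2 scalerAl.
rewrite coef_weight_double ?IHg ?expnS ?mulnA //.
apply: leq_trans (size_scale_leq _ _) _; rewrite size_exprX1.
have : (0 < 2 ^ k)%N by rewrite expn_gt0.
lia.
Qed.

(** Induction on [g]. For g = 0, a nonzero multiple of X + 1 vanishes at 1, hence has at least two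
    nonzero coefficients. Each further step splits off a factor X^N + 1 and doubles the weight. *)
Lemma coef_weight_lower g k (q : {poly R}) :
  (forall a, a != 0 -> (0 < w a)%N) -> q != 0 ->
  (size (q * ('X + 1) ^+ (2 ^ (g + k.+1) - 2 ^ k.+1 + 1))%R <= 2 ^ (g + k.+1))%N ->
  (2 ^ g.+1 <=
   coef_weight (2 ^ (g + k.+1))
     (q * ('X + 1) ^+ (2 ^ (g + k.+1) - 2 ^ k.+1 + 1))%R)%N.
Proof.
move=> w_gt0; elim: g q => [|g IHg] q q0.
  rewrite add0n subnn add0n expr1 expn1; set p := q * _ => sp.
  have p1 : p.[1] = 0.
    by rewrite /p hornerM hornerD hornerX hornerC -mulr2n (pcharf0 charR2) mulr0.
  have p0 : p != 0 by rewrite mulf_neq0 // -[_ + _]expr1 exprX1_neq0.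
  have lt_n : ((size p).-1 < 2 ^ k.+1)%N by rewrite prednK ?size_poly_gt0.
  have lead0 : p`_(size p).-1 != 0 by rewrite -lead_coefE lead_coef_eq0.
  rewrite /coef_weight (bigD1 (Ordinal lt_n)) //=.
  apply: (@leq_add 1 1); first exact: w_gt0.
  rewrite lt0n; apply: contraNneq lead0 => /eqP.
  rewrite sum_nat_eq0 => /forall_inP /= small.
  (* Once the other coefficients vanish, the leading coefficient equals the value at 1, which is
     0. *)
  rewrite -[eqbRHS]p1 (horner_coef_wide 1 sp) (bigD1 (Ordinal lt_n)) //= big1.
    by rewrite addr0 expr1n mulr1.
  move=> i /small wi; rewrite expr1n mulr1; apply: contraTeq wi => /w_gt0.
  by rewrite lt0n.
have le_k : (2 ^ k.+1 <= 2 ^ (g + k.+1))%N by rewrite leq_exp2l // leq_addl.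
rewrite addSn [(2 ^ (g + k.+1).+1)%N]expnS mul2n -addnn -addnBAC // addnAC exprD.
rewrite exprX1_pow2 mulrA; set r := q * _ => sr.
have r0 : r != 0 by rewrite mulf_neq0 ?exprX1_neq0.
have Xn0 : 'X^(2 ^ (g + k.+1)) + 1 != 0 :> {poly R}.
  by rewrite -exprX1_pow2 exprX1_neq0.
have sr' : (size r <= 2 ^ (g + k.+1))%N.
  by move: sr; rewrite size_mul // -exprX1_pow2 size_exprX1; lia.
by rewrite coef_weight_double // expnS leq_mul2l IHg.
Qed.

End CoefWeight.

(** * Reduction modulo u, and multiples of u^2 in the chain ring *)

Section ChainRing.
Variable F : fieldExtType 'F_2.

Lemma pchar_fieldExt2 : 2%N \in [pchar F].
Proof. by rewrite pchar_lalg pchar_Fp. Qed.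

Lemma rmodp_X3 (p : {poly F}) : rmodp p (mk_monic 'X^3) = rmodp p 'X^3.
Proof. by rewrite mk_monic_Xn. Qed.

(** Reduction modulo u; being a ring morphism, it carries divisibility by (x+1)^l down to [F]. *)
Definition residue (r : chain_ring F) : F := (polyn r)`_0.

Lemma residue_is_zmod_morphism : zmod_morphism residue.
Proof. by move=> r t; rewrite /residue /= coefB. Qed.

Lemma residue_is_monoid_morphism : monoid_morphism residue.
Proof.
split=> [|r t]; first by rewrite /residue /= coef1.
rewrite /residue poly_of_qpolyM rmodp_X3.
have := rdivp_eq (monicXn F 3) (polyn r * polyn t) => /(congr1 (coefp 0)) /=.
by rewrite coefD coefMXn add0r coefM big_ord1 => <-.
Qed.

HB.instance Definition _ :=
  GRing.isZmodMorphism.Build (chain_ring F) F residue residue_is_zmod_morphism.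
HB.instance Definition _ :=
  GRing.isMonoidMorphism.Build (chain_ring F) F residue
    residue_is_monoid_morphism.

Lemma polyn_u2 (r : chain_ring F) :
  polyn (u F ^+ 2 * r) = residue r *: 'X^2 :> {poly F}.
Proof.
have uE : polyn (u F) = 'X by rewrite /u qpolyXE ?size_polyXn ?monicXn.
have u2E : polyn (u F ^+ 2) = 'X^2 :> {poly F}.
  by rewrite poly_of_qpolyX uE rmodp_X3 rmodp_small // !size_polyXn.
rewrite poly_of_qpolyM u2E rmodp_X3.
(* Division by X^3: the higher coefficients of [r] go into the quotient, and only the constant one
   survives. *)
have -> : 'X^2 * polyn r = (\poly_(i < 2) r`_i.+1) * 'X^3 + residue r *: 'X^2.
  apply/polyP => i; rewrite coefXnM coefD coefMXn coefZ coefXn coef_poly.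
  case: i => [|[|[|i]]]; rewrite ?mulr0 ?addr0 ?mulr1 ?add0r //=.
  rewrite !subSS !subn0; case: ltnP => // le_i.
  by rewrite big_coef_npoly // mk_monic_Xn size_polyXn.
rewrite rmodp_addl_mul_small ?monicXn // size_polyXn.
by rewrite (leq_ltn_trans (size_scale_leq _ _)) // size_polyXn.
Qed.

End ChainRing.

(** * Codewords as u^2-multiples of polynomials over the field *)

Section CyclicCode.
Variables (F : fieldExtType 'F_2) (s : nat).

Let cyc : {poly chain_ring F} := 'X^(2 ^ s) - 1.

(** The coefficients of [p] are read as constants of the chain ring; every codeword has this form,
    so weights can be computed over [F]. *)
Definition u2_lift (p : {poly F}) : cyclic_ring F s :=
  qpolyC cyc (u F ^+ 2) * in_qpoly cyc (map_poly (qpolyC 'X^3) p).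

Lemma residue_qpolyC (a : F) : residue (qpolyC 'X^3 a) = a.
Proof. by rewrite /residue qpolyCE coefC. Qed.

Lemma u2_residue (r : chain_ring F) :
  u F ^+ 2 * r = u F ^+ 2 * qpolyC 'X^3 (residue r).
Proof. by apply: val_inj; rewrite [LHS]polyn_u2 [RHS]polyn_u2 residue_qpolyC. Qed.

Lemma size_cyc : size (mk_monic cyc) = (2 ^ s).+1.
Proof. by rewrite mk_monic_cyclic -polyC1 size_XnsubC // expn_gt0. Qed.

Lemma polyn_qpolyC_mul (r : chain_ring F) (c : cyclic_ring F s) :
  polyn (qpolyC cyc r * c) = r *: polyn c.
Proof.
rewrite poly_of_qpolyM qpolyCE mul_polyC rmodpZ ?monic_mk_monic //.
by rewrite rmodp_small // size_mk_monic.
Qed.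

Lemma coef_u2_lift (p : {poly F}) i : (size p <= 2 ^ s)%N ->
  (polyn (u2_lift p))`_i = u F ^+ 2 * qpolyC 'X^3 p`_i.
Proof.
move=> sp; rewrite /u2_lift polyn_qpolyC_mul coefZ in_qpoly_small ?coef_map //.
by rewrite size_cyc ltnS (leq_trans (size_poly _ _)).
Qed.

Lemma u2_lift_in_code l (q : {poly F}) :
  code2 l (u2_lift (q * ('X + 1) ^+ l)).
Proof.
exists (in_qpoly cyc (map_poly (qpolyC 'X^3) q)).
rewrite /u2_lift !(rmorphM, rmorphXn, rmorphD, rmorph1) /= map_polyX.
by rewrite mulrCA.
Qed.

(** Reducing modulo x^n - 1, n = 2^s, and then modulo u preserves divisibility by (x+1)^l, because
    x^n - 1 = (x+1)^n over [F] and l <= n. *)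
Lemma code2_u2_lift l (c : cyclic_ring F s) : (l <= 2 ^ s)%N -> code2 l c ->
  exists2 q : {poly F}, (size (q * ('X + 1) ^+ l)%R <= 2 ^ s)%N &
    c = u2_lift (q * ('X + 1) ^+ l).
Proof.
move=> le_l [f ->]; set P := polyn f * ('X + 1) ^+ l.
have -> : f * (qpolyC _ (u F ^+ 2) * ('qX + 1) ^+ l) =
    qpolyC cyc (u F ^+ 2) * in_qpoly cyc P.
  rewrite mulrCA /P in_qpolyM; congr (_ * (_ * _)); last first.
    by rewrite rmorphXn /= in_qpolyD in_qpoly1.
  by apply: val_inj; rewrite /= rmodp_small // size_mk_monic.
set p := map_poly (@residue F) (polyn (in_qpoly cyc P)).
have sp : (size p <= 2 ^ s)%N.
  by rewrite (leq_trans (size_poly _ _)) // -ltnS -size_cyc size_mk_monic.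
have N1 : -1 = 1 :> {poly F}.
  by rewrite oppr_pchar2 // pchar_poly pchar_fieldExt2.
have [q pE] : exists q, p = q * ('X + 1) ^+ l.
  (* Obtained by writing the remainder as [P] minus a multiple of X^n - 1, modulo u, and cancelling
     (X+1)^l. *)
  exists (map_poly (@residue F) (polyn f) -
    map_poly (@residue F) (rdivp P (mk_monic cyc)) * ('X + 1) ^+ (2 ^ s - l)).
  rewrite mulrBl -mulrA -exprD subnK // exprX1_pow2 ?pchar_fieldExt2 //.
  have /(congr1 (map_poly (@residue F))) := rdivp_eq (monic_mk_monic cyc) P.
  rewrite [X in _ = _ (_ * X + _)]mk_monic_cyclic /P.
  rewrite !(rmorphM, rmorphXn, rmorphD, rmorphN, rmorph1) /= !map_polyX.
  rewrite N1 => ->.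
  by rewrite addrC addKr.
exists q; rewrite -pE //; apply: val_inj; apply/polyP => i.
rewrite [RHS]coef_u2_lift //.
apply: etrans (congr1 (coefp i) (polyn_qpolyC_mul _ _)) _ => /=.
by rewrite coefZ coef_map [LHS]u2_residue.
Qed.

End CyclicCode.

(** * Lee weights of codewords and the minimum distance *)

Section LeeDistance.
Variables (m : nat) (F : fieldExtType 'F_2) (B : m.-tuple F).
Hypothesis basisB : basis_of {:F} B.

Lemma lee_weight_field0 : lee_weight_field B 0 = 0%N.
Proof. by apply: eq_card0 => i; rewrite inE linear0 eq_sym oner_eq0. Qed.

Lemma lee_weight_field_gt0 (y : F) : y != 0 -> (0 < lee_weight_field B y)%N.
Proof.
apply: contraNltn; rewrite leqn0 cards_eq0 => /eqP B0.
rewrite (coord_basis basisB (memvf y)) big1 // => i _.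
have /setP/(_ i) := B0; rewrite !inE.
suff F2 (x : 'F_2) : (x == 1) = false -> x = 0 by move/F2->; rewrite scale0r.
by case: x => [[|[|//]]] ltk //= _; apply: val_inj.
Qed.

Lemma lee_weight_field_basis (i : 'I_m) : lee_weight_field B (tnth B i) = 1%N.
Proof.
apply: etrans (cards1 i); congr #|pred_of_set _|.
apply/setP => j; rewrite !inE (tnth_nth 0) coord_free ?(basis_free basisB) //.
by rewrite [j == i]eq_sym; case: (i == j).
Qed.

(** Only the u^2-coefficient c can be nonzero; it counts in a+b+c and in b+c, but not in b. *)
Lemma lee_weight_u2 (a : F) :
  lee_weight_ring B (u F ^+ 2 * qpolyC 'X^3 a) = (2 * lee_weight_field B a)%N.
Proof.
rewrite /lee_weight_ring polyn_u2 residue_qpolyC !coefZ !coefXn !mulr0 mulr1.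
by rewrite !add0r lee_weight_field0 addn0 mul2n addnn.
Qed.

Lemma lee_weight_u2_lift s (p : {poly F}) : (size p <= 2 ^ s)%N ->
  lee_weight B (u2_lift s p) =
  (2 * coef_weight (lee_weight_field B) (2 ^ s) p)%N.
Proof.
move=> sp; rewrite /lee_weight /coef_weight big_distrr /=.
by apply: eq_bigr => i _; rewrite coef_u2_lift // lee_weight_u2.
Qed.

Lemma u2_lift0 s : u2_lift s 0 = 0 :> cyclic_ring F s.
Proof. by rewrite /u2_lift !rmorph0 mulr0. Qed.

Lemma lee_distance_code2 s l d : (l <= 2 ^ s)%N -> (0 < d)%N ->
  (forall q : {poly F}, q != 0 -> (size (q * ('X + 1) ^+ l)%R <= 2 ^ s)%N ->
    (d <= coef_weight (lee_weight_field B) (2 ^ s) (q * ('X + 1) ^+ l)%R)%N) ->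
  (exists2 q : {poly F}, (size (q * ('X + 1) ^+ l)%R <= 2 ^ s)%N &
    coef_weight (lee_weight_field B) (2 ^ s) (q * ('X + 1) ^+ l)%R = d) ->
  lee_distance_is B (@code2 F s l) (2 * d).
Proof.
move=> le_l d0 lower [q sq wq]; split.
  have wc : lee_weight B (u2_lift s (q * ('X + 1) ^+ l)) = (2 * d)%N.
    by rewrite lee_weight_u2_lift // wq.
  exists (u2_lift s (q * ('X + 1) ^+ l)); split=> //; first exact: u2_lift_in_code.
  (* The zero word has weight 0, whereas [d] is positive. *)
  apply: contra_eqN wc => /eqP ->.
  rewrite -u2_lift0 lee_weight_u2_lift ?size_poly0 // eqn_mul2l /= /coef_weight.
  rewrite big1 ?ltn_eqF // => i _.
  by rewrite coef0 lee_weight_field0.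
move=> c /(code2_u2_lift le_l) [p sp ->] c0.
rewrite lee_weight_u2_lift // leq_mul2l /= lower //.
by apply: contraNneq c0 => ->; rewrite mul0r u2_lift0.
Qed.

(** Here s = g + k + 1. The codes shrink as [l] grows: the lower bound is proved at the smallest
    exponent, and a word of the code with the largest one attains it throughout. *)
Lemma lee_distance_code2_pos g k l : (0 < m)%N ->
  (2 ^ (g + k.+1) - 2 ^ k.+1 + 1 <= l <= 2 ^ (g + k.+1) - 2 ^ k)%N ->
  lee_distance_is B (@code2 F (g + k.+1) l) (2 ^ (g + 2)).
Proof.
move=> m0 /andP[lo hi]; have k0 : (0 < 2 ^ k)%N by rewrite expn_gt0.
rewrite addn2 expnS.
have le_l : (l <= 2 ^ (g + k.+1))%N by rewrite (leq_trans hi) ?leq_subr.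
apply: lee_distance_code2; rewrite ?expn_gt0 //.
  move=> q q0; rewrite -(subnK lo) exprD mulrA => sq.
  apply: coef_weight_lower => //; first exact: pchar_fieldExt2.
    exact: lee_weight_field_gt0.
  by rewrite mulf_neq0 ?exprX1_neq0.
pose a := tnth B (Ordinal m0).
(* This factor raises the exponent [l] to 2^s - 2^k, where the weight is known exactly. *)
exists (a *: ('X + 1) ^+ (2 ^ (g + k.+1) - 2 ^ k - l)).
  rewrite -scalerAl -exprD subnK // (leq_trans (size_scale_leq _ _)) //.
  by rewrite size_exprX1; move: lo hi; rewrite expnS; lia.
(* Regrouping g + (k+1) as (g+1) + k yields the weight 2^(g+1). *)
rewrite -scalerAl -exprD subnK // -addSnnS.
rewrite coef_weight_exprX1 ?lee_weight_field_basis ?muln1 //.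
  exact: pchar_fieldExt2.
exact: lee_weight_field0.
Qed.

Lemma lee_distance_code2_0 s : (0 < m)%N ->
  lee_distance_is B (@code2 F s 0) 2.
Proof.
move=> m0; rewrite -[2%N]muln1.
apply: lee_distance_code2 => // [q q0|].
  rewrite mulr1; apply: coef_weight_gt0 => //; exact: lee_weight_field_gt0.
pose a := tnth B (Ordinal m0).
exists a%:P; rewrite mulr1.
  by rewrite (leq_trans (size_polyC_leq1 _)) ?expn_gt0.
(* A constant is the case g = 0, where the exponent 2^s - 2^s vanishes. *)
have := coef_weight_exprX1 (pchar_fieldExt2 F) a 0 s lee_weight_field0.
by rewrite add0n subnn expr0 alg_polyC lee_weight_field_basis.
Qed.

End LeeDistance.

Theorem theorem3p2 (m s : nat) (hm : (0 < m)%N) (hs : (0 < s)%N)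
    (F : fieldExtType 'F_2) (hF : \dim {:F}%VS = m)
    (l : nat) (hl : (l <= 2 ^ s - 1)%N)
    (B : m.-tuple F) (hB : trace_orthogonal_basis B) :
  [/\ l = 0%N -> lee_distance_is B (@code2 F s l) 2,
      (1 <= l <= 2 ^ (s - 1))%N -> lee_distance_is B (@code2 F s l) 4
    & forall g : nat, (1 <= g <= s - 1)%N ->
        (2 ^ s - 2 ^ (s - g) + 1 <= l
           <= 2 ^ s - 2 ^ (s - g) + 2 ^ (s - g - 1))%N ->
        lee_distance_is B (@code2 F s l) (2 ^ (g + 2))].
Proof.
have [basisB _] := hB.
(* Allowing g = 0 makes this cover the range 1 <= l <= 2^(s-1) as well. *)
have step g : (g < s)%N ->
    (2 ^ s - 2 ^ (s - g) + 1 <= l <= 2 ^ s - 2 ^ (s - g) + 2 ^ (s - g - 1))%N ->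
    lee_distance_is B (@code2 F s l) (2 ^ (g + 2)).
  move=> lt_g; have sE : s = (g + (s - g - 1).+1)%N by lia.
  move: (s - g - 1)%N sE => k -> /andP[lo hi].
  move: lo hi; rewrite addKn => lo hi.
  apply: lee_distance_code2_pos => //; rewrite lo (leq_trans hi) //.
  (* The upper bound 2^s - 2^(k+1) + 2^k is 2^s - 2^k, as the truncated subtraction is exact. *)
  have : (2 ^ k.+1 <= 2 ^ (g + k.+1))%N by rewrite leq_exp2l // leq_addl.
  by rewrite expnS; lia.
split=> [->|l_range|g /andP[_ g_le]]; first exact: lee_distance_code2_0.
  by apply: (step 0%N) => //; rewrite subn0 subnn.
by apply: step; lia.
Qed.
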